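(* If $G=D_{2p}$, where $p$ is a prime, then $R(\mathcal{B}(G))=1+p\sqrt{3}+\sqrt{p-1}\left(\sqrt{p+1}+\sqrt{3p}\right)$, $\mathrm{ABC}(\mathcal{B}(G))=p\sqrt{6}+\sqrt{p-1}\left(\sqrt{(p+1)(p^2-2)}+\sqrt{3p(3p^2-3p-1)}\right)$, $\mathrm{GA}(\mathcal{B}(G))=\frac{2+3p\sqrt{3}}{2}+\sqrt{(p-1)^3}\left(\frac{2\sqrt{(p+1)^3}}{p^2}+\frac{6p\sqrt{3p}}{3p^2-3p+1}\right)$, $H(\mathcal{B}(G))=\frac{2+3p}{2}+(p-1)\left(\frac{2p+2}{p^2}+\frac{6p}{3p^2-3p+1}\right)$ and $\mathrm{SCI}(\mathcal{B}(G))=\frac{1}{\sqrt{2}}+\frac{3p}{2}+(p-1)\left(\frac{p+1}{p}+\frac{3p}{\sqrt{3p^2-3p+1}}\right)$.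
   Context: $D_{2n}=\langle a,b : a^n=b^2=1,\ bab=a^{-1}\rangle$ is the dihedral group of order $2n$. For a finite group $G$, $L(G)$ denotes the set of all subgroups of $G$. The subgroup generating bipartite graph $\mathcal{B}(G)$ is the simple undirected bipartite graph whose vertex set is the disjoint union $(G\times G)\sqcup L(G)$, where $(x,y)\in G\times G$ and $H\in L(G)$ are adjacent if and only if $H=\langle x,y\rangle$ (the subgroup generated by $x$ and $y$); there are no other edges. For a finite simple graph $\mathcal{G}$ with edge set $e(\mathcal{G})$, writing $d(u)$ for the degree of $u$ in $\mathcal{G}$: the Randic Connectivity index is $R(\mathcal{G})=\sum_{uv\in e(\mathcal{G})}(d(u)d(v))^{-1/2}$; the Atom-Bond Connectivity index is $\mathrm{ABC}(\mathcal{G})=\sum_{uv\in e(\mathcal{G})}\left(\frac{d(u)+d(v)-2}{d(u)d(v)}\right)^{1/2}$; the Geometric-Arithmetic index is $\mathrm{GA}(\mathcal{G})=\sum_{uv\in e(\mathcal{G})}\frac{\sqrt{d(u)d(v)}}{\frac12(d(u)+d(v))}$; the Harmonic index is $H(\mathcal{G})=\sum_{uv\in e(\mathcal{G})}\frac{2}{d(u)+d(v)}$; the Sum-Connectivity index is $\mathrm{SCI}(\mathcal{G})=\sum_{uv\in e(\mathcal{G})}(d(u)+d(v))^{-1/2}$. *)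

(* Defs.v *)
From mathcomp Require Import all_boot all_order all_algebra all_fingroup.
From mathcomp Require Import all_solvable.

Set Implicit Arguments.
Unset Strict Implicit.
Unset Printing Implicit Defensive.

Import GRing.Theory Num.Theory.

(* The library builds 'D_(2 * n) as a semidirect product; for n > 1 it has the
   usual presentation. *)
Lemma dihedral_presentation (n : nat) (n_gt1 : (1 < n)%N) :
  ('D_(2 * n)%N \isog Grp (a : b : a ^+ n, b ^+ 2, b * a * b = a^-1))%g.
Proof.
rewrite mul2n => rT H; rewrite (Grp_dihedral n_gt1).
apply/existsP/existsP => -[[x y]] /= /eqP[<- xn y2 xy]; exists (x, y);
  rewrite !xpair_eqE /= eqxx xn y2 !eqxx /=;
  have yV : (y^-1 = y)%g by apply/eqP; rewrite eq_invg_mul -expg2 y2.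
  by rewrite -xy /conjg yV mulgA.
by rewrite -xy /conjg yV mulgA.
Qed.

Record sgraph := SGraph {
  vertex :> finType;
  adj : rel vertex;
  adj_sym : symmetric adj;
  adj_irrefl : irreflexive adj
}.

Section TopologicalIndices.

Variables (R : rcfType) (Gr : sgraph).

Definition edges : {set {set Gr}} :=
  [set E | [exists u, exists v, adj u v && (E == [set u; v])]].

Definition deg (u : Gr) : nat := #|[set v | adj u v]|.

Local Open Scope ring_scope.

(* An edge is a two-element set E = {u, v} since adj is irreflexive, so that
   degD E = d(u) + d(v) and degM E = d(u) d(v). *)
Definition degD (E : {set Gr}) : R := \sum_(w in E) (deg w)%:R.
Definition degM (E : {set Gr}) : R := \prod_(w in E) (deg w)%:R.

Definition Randic : R := \sum_(E in edges) (Num.sqrt (degM E))^-1.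

Definition ABC : R :=
  \sum_(E in edges) Num.sqrt ((degD E - 2%:R) / degM E).

Definition GA : R :=
  \sum_(E in edges) Num.sqrt (degM E) / (2%:R^-1 * degD E).

Definition Harmonic : R := \sum_(E in edges) 2%:R / degD E.

Definition SCI : R := \sum_(E in edges) (Num.sqrt (degD E))^-1.

End TopologicalIndices.

Arguments Randic R Gr : clear implicits.
Arguments ABC R Gr : clear implicits.
Arguments GA R Gr : clear implicits.
Arguments Harmonic R Gr : clear implicits.
Arguments SCI R Gr : clear implicits.

Section SubgroupGeneratingBipartiteGraph.

Variable gT : finGroupType.

Definition sgb_vertex : finType := ((gT * gT) + {group gT})%type.

Definition sgb_adj (u v : sgb_vertex) : bool :=
  match u, v with
  | inl (x, y), inr H => H :==: <<[set x; y]>>%g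
  | inr H, inl (x, y) => H :==: <<[set x; y]>>%g
  | _, _ => false
  end.

Lemma sgb_adj_sym : symmetric sgb_adj.
Proof. by move=> [[x y]|H] [[z t]|K]. Qed.

Lemma sgb_adj_irrefl : irreflexive sgb_adj.
Proof. by move=> [[x y]|H]. Qed.

Definition sgb_graph : sgraph := SGraph sgb_adj_sym sgb_adj_irrefl.

End SubgroupGeneratingBipartiteGraph.

(* Main.v *)
Require Import Defs.
From mathcomp Require Import all_boot all_order all_algebra all_fingroup.
From mathcomp Require Import all_solvable.
From mathcomp Require Import ring lra zify.

Set Implicit Arguments.
Unset Strict Implicit.
Unset Printing Implicit Defensive.

Import Order.TTheory GRing.Theory Num.Theory.

(** In the subgroup generating bipartite graph every pair (x, y) has degree 1:
    its only neighbour is the subgroup <x, y>.  So each edge has end degrees 1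
    and d(H), where d(H) is the number of pairs that generate H, and H lies on
    d(H) edges.  An index that sums Phi (d(u) + d(v)) (d(u) d(v)) over the edges
    is therefore the sum of d(H) Phi (1 + d(H)) (d(H)) over all subgroups H
    (sum_edges_sgb).

    Let G be dihedral of order 2p with p prime.  The rotations form a subgroup
    A of prime order p, and each of the p elements outside A is an involution
    (dihedral_rotations).  For p = 2 the group is the Klein four-group and A is
    one of its three subgroups of order 2.  These facts alone determine the
    subgroups, with no case distinction on p: they are 1, A, G and the p groups
    <t> with t outside A (reflection_subgroupP).  In a group H of prime order
    every pair but (1, 1) generates, so d(H) = |H|^2 - 1.  This gives d(1) = 1,
    d(A) = p^2 - 1 and d(<t>) = 3; since all the degrees add up to |G|^2 = 4p^2,
    what remains is d(G) = 3p(p - 1).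

    The five formulas follow by substituting these degrees and splitting the
    radicals of p^2 - 1 = (p - 1)(p + 1) and 3p(p - 1). *)

(** * Pairs generating a subgroup *)

Section Groups.
Local Open Scope group_scope.
Variable gT : finGroupType.

(** The neighbourhood of [H] in the graph, as a set of pairs. *)
Definition gen_pairs (H : {group gT}) : {set gT * gT} :=
  [set xy | H :==: <<[set xy.1; xy.2]>>].

Lemma sum_card_gen_pairs : (\sum_(H : {group gT}) #|gen_pairs H| = #|gT| ^ 2)%N.
Proof.
rewrite expnS expn1 -card_prod -sum1_card.
rewrite (partition_big (fun xy : gT * gT => <<[set xy.1; xy.2]>>%G) xpredT) //=.
apply: eq_bigr => H _; rewrite -sum1_card.
by apply: eq_bigl => xy; rewrite inE /= eq_sym -val_eqE.
Qed.

Lemma card_gen_pairs1 : #|gen_pairs 1| = 1%N.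
Proof.
apply/eqP/cards1P; exists (1, 1); apply/setP=> -[x y].
by rewrite !inE xpair_eqE /= eq_sym -subG1 gen_subG subUset !sub1set !inE.
Qed.

(** A subgroup of a group of prime order that is not trivial is the whole group,
    so a pair in [H] generates [H] as soon as one of its entries is not 1. *)
Lemma card_gen_pairs_prime (H : {group gT}) :
  prime #|H| -> #|gen_pairs H| = (#|H| ^ 2 - 1)%N.
Proof.
move=> H_prime; have -> : gen_pairs H = setX H H :\ (1, 1).
  apply/setP=> -[x y]; rewrite !inE /= xpair_eqE.
  apply/eqP/and3P => [defH | [xy_neq1 Hx Hy]].
    have sxyH: [set x; y] \subset H by rewrite defH subset_gen.
    move: (sxyH); rewrite subUset !sub1set => /andP[-> ->]; split=> //.
    apply/negP=> /andP[/eqP x1 /eqP y1]; move: H_prime.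
    by rewrite defH x1 y1 setUid genGid cards1.
  have sKH: <<[set x; y]>> \subset H by rewrite gen_subG subUset !sub1set Hx Hy.
  apply/eqP; rewrite eqEsubset sKH andbT.
  have [//|/(prime_TIg H_prime)] := boolP (H \subset <<[set x; y]>>).
  rewrite (setIidPr sKH) => /trivgP; rewrite gen_subG subUset !sub1set !inE.
  by rewrite (negPf xy_neq1).
by rewrite cardsDS ?sub1set ?inE ?group1 // cardsX cards1 expnS expn1.
Qed.

(** * Subgroups of a dihedral group of order 2p *)

(** All that the sequel needs to know about the dihedral group.  With the
    generators a and b of the presentation, A = <a> has order exactly p because
    <a><b> is the whole group; an element outside A is some a^i b, and
    (a^i b)^2 = a^i (b a^i b) = a^i a^-i = 1. *)
Lemma dihedral_rotations p : prime p -> [set: gT] \isog 'D_(2 * p) ->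
  #|gT| = (2 * p)%N /\
  exists2 A : {group gT}, #|A| = p & forall t, t \notin A -> #[t] = 2.
Proof.
move=> p_prime isoD; have p_gt1 := prime_gt1 p_prime.
have cardG: #|gT| = (2 * p)%N.
  by rewrite -cardsT (card_isog isoD) mul2n card_dihedral.
split=> //.
have := isog_hom isoD; rewrite (dihedral_presentation p_gt1).
case/existsP=> -[a b] /= /eqP[genG a_p b_2 bab].
have Nb: b \in 'N(<[a]>).
  rewrite -cycle_subG cycle_subG inE -cycleJ cycle_subG /=.
  have bV : b^-1 = b by apply/eqP; rewrite eq_invg_mul -expg2 b_2.
  by rewrite conjgE bV mulgA bab groupV cycle_id.
have defG: <[a]> * <[b]> = [set: gT].
  by rewrite -norm_joinEr ?cycle_subG.
have oa : #[a] <= p by rewrite dvdn_leq ?prime_gt0 // order_dvdn a_p.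
have ob : #[b] <= 2 by rewrite dvdn_leq // order_dvdn b_2.
exists <[a]>%G.
  (* |G| = |<a><b>| <= |<a>| |<b>| <= 2 |<a>| *)
  apply/eqP; rewrite eqn_leq oa /= -(leq_pmul2l (isT : 0 < 2)%N).
  rewrite -cardG -cardsT -defG.
  apply: leq_trans (_ : #|<[a]>| * #|<[b]>| <= _)%N; last first.
    by rewrite mulnC leq_mul2r ob orbT.
  by rewrite mul_cardG leq_pmulr ?cardG_gt0.
move=> t; have: t \in <[a]> * <[b]> by rewrite defG inE.
case/mulsgP=> _ _ /cycleP[i ->] /cycleP[j ->] -> notA.
(* an even j would put t in <a> *)
have b_j : b ^+ j = b.
  move: notA; rewrite (divn_eq j 2) expgD mulnC expgM b_2 expg1n mul1g.
  case: (j %% 2)%N (ltn_pmod j (isT : 0 < 2)%N) => [|[|]] //.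
  by rewrite mulg1 mem_cycle.
rewrite b_j in notA *; apply: nt_prime_order => //.
  rewrite expg2 -mulgA (mulgA b).
  suff -> : b * a ^+ i = a ^- i * b by rewrite -mulgA -expg2 b_2 mulg1 mulgV.
  elim: i {notA} => [|i IHi]; first by rewrite mulg1 invg1 mul1g.
  have ba : b * a = a^-1 * b by rewrite -bab -mulgA -expg2 b_2 mulg1.
  by rewrite {1}expgS expgSr invMg mulgA ba -mulgA IHi mulgA.
by apply: contraNneq notA => ->; rewrite group1.
Qed.

Section Subgroups.
Variables (p : nat) (A : {group gT}).
Hypotheses (p_prime : prime p) (cardG : #|gT| = (2 * p)%N) (cardA : #|A| = p).
Hypothesis reflA : forall t, t \notin A -> #[t] = 2.

(** Let H be none of 1, A, G.  As A has prime order, H is not inside A; as A has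
    index 2, A is not inside H.  Then A meets H trivially, so |A| |H| <= 2p and
    |H| <= 2, and any t in H outside A generates H. *)
Lemma reflection_subgroupP (H : {group gT}) :
  reflect (exists2 t, t \notin A & H = <[t]>%G)
          [&& H != 1%G, H != A & H != [set: gT]%G].
Proof.
have A_prime: prime #|A| by rewrite cardA.
apply: (iffP and3P) => [[H_neq1 H_neqA H_neqG] | [t notAt ->]].
  have sHA_F: ~~ (H \subset A).
    apply: contra H_neqA => sHA; apply/eqP/val_inj/eqP.
    rewrite eqEsubset sHA /=.
    have [//|/(prime_TIg A_prime)] := boolP (A \subset H).
    by rewrite (setIidPr sHA) => H1; case/eqP: H_neq1; apply: val_inj.
  have sAH_F: ~~ (A \subset H).
    apply/negP=> sAH; have := cardSg (subsetT H); have := cardSg sAH.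
    rewrite cardsT cardG cardA => /dvdnP[k cardH].
    rewrite cardH dvdn_pmul2r ?prime_gt0 // => /(dvdn_leq (isT : 0 < 2)%N).
    case: k cardH => [|[|[|]]] // cardH _.
    - by move: (cardG_gt0 H); rewrite cardH.
    - case/eqP: H_neqA; apply/val_inj/esym/eqP.
      by rewrite eqEcard sAH cardH cardA mul1n /=.
    - case/eqP: H_neqG; apply/val_inj/eqP.
      by rewrite eqEcard subsetT cardsT cardG cardH /=.
  have [t Ht notAt] := subsetPn sHA_F.
  exists t => //; apply/val_inj/esym/eqP; rewrite eqEcard cycle_subG Ht /=.
  rewrite [#|<[t]>|](reflA notAt) -(leq_pmul2r (prime_gt0 p_prime)) -cardG.
  by rewrite -{1}cardA mulnC mul_cardG prime_TIg // cards1 muln1 max_card.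
split; apply/eqP=> /(congr1 val) /= defA.
- by have := reflA notAt; rewrite /order defA cards1.
- by case/negP: notAt; rewrite -defA cycle_id.
have := reflA notAt; rewrite /order defA cardsT cardG.
by case: p p_prime => [|[|]] //= n _; rewrite mulnC.
Qed.

Lemma cycle_reflection_inj : {in ~: A &, injective (fun t => <[t]>%G)}.
Proof.
move=> t u; rewrite !inE => /reflA t2 /reflA u2 /(congr1 val) /= tu.
have: t \in <[u]> by rewrite -tu cycle_id.
rewrite (cycle2g u2) !inE => /orP[/eqP t1|/eqP //].
by move: t2; rewrite t1 order1.
Qed.

Lemma sum_dihedral_subgroups (V : nmodType) (F : {group gT} -> V) :
  (\sum_(H : {group gT}) F H =
     F 1%G + (F A + (F [set: gT]%G + \sum_(t in ~: A) F <[t]>%G)))%R.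
Proof.
have p_gt1 := prime_gt1 p_prime.
rewrite (bigD1 1%G) //= (bigD1 A) /=; last first.
  by apply: contraTneq p_gt1 => A1; rewrite -cardA A1 cards1.
rewrite (bigD1 [set: gT]%G) /=; last first.
  apply/andP; split; apply/eqP=> /(congr1 (fun H : {group gT} => #|H|)) /=.
    by rewrite cardsT cardG cards1 => /(congr1 odd); rewrite oddM.
  rewrite cardsT cardG cardA => /eqP.
  by rewrite -{2}[p]mul1n eqn_pmul2r // prime_gt0.
do 3!congr (_ + _)%R.
rewrite -(big_imset F cycle_reflection_inj) /=.
apply: eq_bigl => H; rewrite -andbA.
apply/reflection_subgroupP/imsetP => -[t].
  by exists t; rewrite // inE.
by rewrite inE; exists t.
Qed.

Lemma card_reflections : #|~: A| = p.
Proof. by rewrite cardsCs setCK cardA cardG mul2n -addnn addnK. Qed.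

Lemma card_gen_pairs_reflection t : t \notin A -> #|gen_pairs <[t]>| = 3%N.
Proof.
by move=> /reflA t2; rewrite card_gen_pairs_prime [#|_|]t2.
Qed.

(** The pairs that generate the whole group are those left over when the pairs
    that generate a proper subgroup are taken away from all 4p^2 of them. *)
Lemma card_gen_pairs_dihedral : #|gen_pairs [set: gT]| = (3 * p * (p - 1))%N.
Proof.
have := sum_card_gen_pairs; rewrite sum_dihedral_subgroups card_gen_pairs1.
rewrite card_gen_pairs_prime cardA // cardG.
under eq_bigr => t do
  [rewrite inE => notAt; rewrite card_gen_pairs_reflection //].
rewrite sum_nat_const card_reflections.
rewrite -[LHS]/(1 + (p ^ 2 - 1 + (#|gen_pairs [set: gT]| + p * 3)))%N.
have := prime_gt0 p_prime; case: (p) => // n _; rewrite subn1 /=.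
nia.
Qed.

End Subgroups.
End Groups.

(** * Sums over the edges *)

Section Edges.
Variable gT : finGroupType.
Let B := sgb_graph gT.

Definition pair_edge (xy : gT * gT) : {set B} :=
  [set (inl xy : B); (inr <<[set xy.1; xy.2]>>%G : B)].

Lemma edges_sgb : edges B = [set pair_edge xy | xy in [set: gT * gT]].
Proof.
apply/setP=> E; rewrite inE; apply/existsP/imsetP => [[u]|[[x y] _ ->]].
  case/existsP=> v /andP[uv /eqP->].
  case: u v uv => [[x y]|H] [[z t]|K] //= /eqP/val_inj->.
    by exists (x, y); rewrite ?inE.
  by exists (z, t); rewrite ?inE //; apply: setUC.
exists (inl (x, y)); apply/existsP; exists (inr <<[set x; y]>>%G).
by rewrite /= !eqxx.
Qed.

Lemma pair_edge_inj : injective pair_edge.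
Proof.
move=> xy zt /setP/(_ (inl xy : B)); rewrite !inE eqxx /= orbF.
by move/esym/eqP=> -[].
Qed.

Lemma deg_pair (xy : gT * gT) : deg (inl xy : B) = 1%N.
Proof.
case: xy => x y; apply/eqP/cards1P; exists (inr <<[set x; y]>>%G).
by apply/setP=> -[[z t]|H]; rewrite !inE //= -val_eqE.
Qed.

Lemma deg_subgroup (H : {group gT}) : deg (inr H : B) = #|gen_pairs H|.
Proof.
rewrite -(card_imset (mem (gen_pairs H)) (@inl_inj _ {group gT})).
apply: eq_card => -[[x y]|K]; rewrite !inE /=.
  by rewrite (mem_imset _ _ (@inl_inj _ _)) inE.
by apply/esym/negbTE/imsetP => -[].
Qed.

Local Open Scope ring_scope.

(** An edge is determined by its pair, which has degree 1; grouping the pairs by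
    the subgroup that they generate turns the sum over edges into one over
    subgroups. *)
Lemma sum_edges_sgb (R : rcfType) (Phi : R -> R -> R) :
  \sum_(E in edges B) Phi (degD R E) (degM R E) =
  \sum_(H : {group gT}) Phi (1 + #|gen_pairs H|%:R) #|gen_pairs H|%:R
                        *+ #|gen_pairs H|.
Proof.
rewrite edges_sgb big_imset /=; last by move=> ? ? _ _ /pair_edge_inj.
rewrite (partition_big (fun xy : gT * gT => <<[set xy.1; xy.2]>>%G) xpredT) //=.
apply: eq_bigr => H _; rewrite -sumr_const.
apply: eq_big => [xy | xy /andP[_ /eqP <-]].
  by rewrite !inE eq_sym -val_eqE.
have notin: (inl xy : B) \notin [set (inr <<[set xy.1; xy.2]>>%G : B)].
  by rewrite inE.
rewrite /degD /degM /pair_edge !big_setU1 //= !big_set1.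
by rewrite deg_pair deg_subgroup mul1r.
Qed.

(** The four terms come from the subgroups 1, <t> with t a reflection, A and
    G; [g d] is the total contribution of the edges at a subgroup of degree
    [d]. *)
Lemma sum_edges_dihedral (R : rcfType) (Phi : R -> R -> R) (p : nat) :
  prime p -> ([set: gT] \isog 'D_(2 * p)%N)%g ->
  let q : R := p%:R in
  let g d : R := d * Phi (1 + d) d in
  \sum_(E in edges B) Phi (degD R E) (degM R E) =
    g 1 + q * g 3 + g (q ^+ 2 - 1) + g (3 * q * (q - 1)).
Proof.
move=> p_prime isoD q g.
have [cardG [A cardA reflA]] := dihedral_rotations p_prime isoD.
have natq1 : (p - 1)%:R = q - 1 by rewrite natrB ?prime_gt0.
rewrite sum_edges_sgb (sum_dihedral_subgroups p_prime cardG cardA reflA).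
rewrite card_gen_pairs1 card_gen_pairs_prime cardA //.
rewrite (card_gen_pairs_dihedral p_prime cardG cardA reflA).
rewrite (eq_bigr (fun _ => g 3)) => [|t]; last first.
  rewrite inE => notAt; rewrite (card_gen_pairs_reflection reflA notAt).
  by rewrite -[LHS]mulr_natl.
rewrite sumr_const (card_reflections cardG cardA).
rewrite -!(mulr_natl (Phi _ _)) -(mulr_natl (g 3)).
rewrite natrB ?expn_gt0 ?prime_gt0 // natrX !natrM natq1 -/q.
rewrite /g; ring.
Qed.
End Edges.

(** * The five indices *)

Section Radicals.
Local Open Scope ring_scope.
Variable R : rcfType.
Implicit Types x d : R.
Local Notation s := (Num.sqrt : R -> R).

Lemma sqrt_cube x : 0 <= x -> s (x ^+ 3) = x * s x.
Proof. by move=> x0; rewrite exprSr sqrtrM ?sqr_ge0 // sqrtr_sqr ger0_norm. Qed.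

Lemma mul_inv_sqrt d : 0 < d -> d * (s d)^-1 = s d.
Proof.
move=> d0; have sd0 : s d != 0 by rewrite sqrtr_eq0 -ltNge.
by rewrite -{1}(sqr_sqrtr (ltW d0)) expr2 mulfK.
Qed.

Lemma mul_sqrt_div d x : 0 < d -> d * s (x / d) = s (d * x).
Proof.
move=> d0; have -> : d * x = d ^+ 2 * (x / d) by field; rewrite gt_eqF.
by rewrite [RHS]sqrtrM ?sqr_ge0 // sqrtr_sqr gtr0_norm.
Qed.

End Radicals.

Local Open Scope ring_scope.

Theorem theorem4p4 (R : rcfType) (p : nat) (p_prime : prime p)
    (gT : finGroupType) (gT_dihedral : ([set: gT] \isog 'D_(2 * p)%N)%g) :
  let B := sgb_graph gT in
  let q : R := p%:R in
  let s : R -> R := Num.sqrt in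
  [/\ Randic R B =
        1 + q * s 3 + s (q - 1) * (s (q + 1) + s (3 * q)),
      ABC R B =
        q * s 6 + s (q - 1) *
          (s ((q + 1) * (q ^+ 2 - 2)) +
           s (3 * q * (3 * q ^+ 2 - 3 * q - 1))),
      GA R B =
        (2 + 3 * q * s 3) / 2 + s ((q - 1) ^+ 3) *
          (2 * s ((q + 1) ^+ 3) / q ^+ 2 +
           6 * q * s (3 * q) / (3 * q ^+ 2 - 3 * q + 1)),
      Harmonic R B =
        (2 + 3 * q) / 2 + (q - 1) *
          ((2 * q + 2) / q ^+ 2 + 6 * q / (3 * q ^+ 2 - 3 * q + 1))
    & SCI R B =
        (s 2)^-1 + 3 * q / 2 + (q - 1) *
          ((q + 1) / q + 3 * q / s (3 * q ^+ 2 - 3 * q + 1))].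
Proof.
move=> B q s.
have sumE (Phi : R -> R -> R) := sum_edges_dihedral Phi p_prime gT_dihedral.
have q_ge2 : 2 <= q by rewrite ler_nat prime_gt1.
have q1_ge0 : 0 <= q - 1 by lra.
have q1'_ge0 : 0 <= q + 1 by lra.
have dA_gt0 : 0 < q ^+ 2 - 1 by nra.
have dG_gt0 : 0 < 3 * q * (q - 1) by nra.
have q_neq0 : q != 0 by apply/eqP; lra.
have dG1_neq0 : 3 * q ^+ 2 - 3 * q + 1 != 0 by apply/eqP; nra.
have sA : s (q ^+ 2 - 1) = s (q - 1) * s (q + 1).
  by rewrite -[1 in LHS](expr1n _ 2) subr_sqr /s sqrtrM.
have sG : s (3 * q * (q - 1)) = s (q - 1) * s (3 * q).
  by rewrite [3 * q * _]mulrC /s (sqrtrM _ q1_ge0).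
have dA1 : 1 + (q ^+ 2 - 1) = q ^+ 2 by ring.
have dG1 : 1 + 3 * q * (q - 1) = 3 * q ^+ 2 - 3 * q + 1 by ring.
split.
- rewrite /Randic (sumE (fun _ M => (s M)^-1)) /s.
  rewrite !mul_inv_sqrt // ?ltr0n // -/s sA sG /s sqrtr1; ring.
- rewrite /ABC (sumE (fun D M => s ((D - 2%:R) / M))) /s.
  rewrite !mul_sqrt_div // ?ltr0n // -/s.
  have -> : s (1 * (1 + 1 - 2%:R)) = 0.
    by rewrite (_ : 1 * _ = 0); [exact: sqrtr0 | ring].
  have -> : 3 * (1 + 3 - 2) = 6 :> R by ring.
  have -> : (q ^+ 2 - 1) * (1 + (q ^+ 2 - 1) - 2) =
            (q - 1) * ((q + 1) * (q ^+ 2 - 2)) by ring.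
  have -> : 3 * q * (q - 1) * (1 + 3 * q * (q - 1) - 2) =
            (q - 1) * (3 * q * (3 * q ^+ 2 - 3 * q - 1)) by ring.
  rewrite /s !(sqrtrM _ q1_ge0); ring.
- rewrite /GA (sumE (fun D M => s M / (2%:R^-1 * D))) sA sG dA1 dG1.
  rewrite /s !sqrt_cube // sqrtr1.
  by field; rewrite dG1_neq0.
- rewrite /Harmonic (sumE (fun D _ => 2%:R / D)) dA1 dG1.
  by field; rewrite dG1_neq0.
rewrite /SCI (sumE (fun D _ => (s D)^-1)) dA1 dG1.
have -> : s (q ^+ 2) = q by rewrite /s sqrtr_sqr ger0_norm //; lra.
have -> : s (1 + 3) = 2.
  by rewrite (_ : 1 + 3 = 2 ^+ 2); [rewrite /s sqrtr_sqr ger0_norm | ring].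
have s_neq0 x : 0 < x -> s x != 0 by move=> ?; rewrite /s sqrtr_eq0 -ltNge.
have s2_neq0 : s 2 != 0 by apply: s_neq0.
have sG1_neq0 : s (3 * q ^+ 2 - 3 * q + 1) != 0 by apply: s_neq0; nra.
rewrite (_ : 1 + 1 = 2 :> R) //; by field; rewrite q_neq0 sG1_neq0 s2_neq0.
Qed.
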